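(* Suppose $\eta_{N,M,r}$ satisfies $0<\check\eta\le\eta_{N,M,r}\le\hat\eta$ for all $N$, with constants $\check\eta,\hat\eta$ independent of $N$. Then for any $0<\epsilon<1$ there exist $N'$ and $M'>0$ such that, for all $N>N'$, at most $2M'$ eigenvalues of the matrix $\tilde{\mathcal M}_{N-1}-\tilde{\mathcal P}_{N-1}$ have absolute values exceeding $\epsilon$.
   Context: Let $0<\gamma<1$, $\alpha\in(0,2)$, $\mu\in(\alpha,2]$, $\nu=\mu-\alpha$, $\kappa_\mu=1$ if $\mu\in(\alpha,2)$ and $\kappa_\mu=2$ if $\mu=2$. For each $N$ let $\tilde A=\tilde A_{N-1}=[\tilde a_{ij}]_{i,j=1,\dots,N-1}$ be the symmetric Toeplitz matrix $$\tilde a_{ij}=\begin{cases}\sum\limits_{\ell=2}^{N-1}\frac{(\ell+1)^\nu-(\ell-1)^\nu}{\ell^\mu}+\frac{N^\nu-(N-1)^\nu}{N^\mu}+(2^\nu+\kappa_\mu-1)+\frac{2\nu}{\alpha N^\alpha},& j=i,\\[2mm] -\frac{2^\nu+\kappa_\mu-1}{2},& j=i\pm1,\\[1mm] -\frac{(|j-i|+1)^\nu-(|j-i|-1)^\nu}{2|j-i|^\mu},& j\neq i,\,i\pm1,\end{cases}$$ and let $s(\tilde A)$ be its Strang circulant approximation: the circulant matrix of order $N-1$ with first column $[\tilde a_{11},\dots,\tilde a_{1,\lfloor (N+1)/2\rfloor},\tilde a_{1,\lfloor N/2\rfloor},\dots,\tilde a_{12}]^\top$. The diffusivity is taken independent of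 $x$, and, following the paper's convention, the dependence on the time level $m$ is suppressed: $\kappa>0$ denotes a constant (the diffusivity value), and $\eta_{N,M,r}=\frac{b^{(m,\gamma)}_m}{\Gamma(1-\gamma)C^h_{\alpha,\mu}}$, where $b^{(m,\gamma)}_m=\frac1{\tau_m}\int_{t_{m-1}}^{t_m}(t_m-s)^{-\gamma}ds$, $t_m=(m/M)^rT$, $\tau_m=t_m-t_{m-1}$, $C^h_{\alpha,\mu}=\frac{c_{1,\alpha}}{\nu h^\alpha}$, $h=2l/N$, $c_{1,\alpha}=\frac{2^{\alpha-1}\alpha\Gamma(\frac{\alpha+1}{2})}{\sqrt\pi\,\Gamma(1-\alpha/2)}$, with fixed $T,l>0$ and positive integers $M,r$ chosen depending on $N$. Put $$\tilde{\mathcal M}_{N-1}=\eta_{N,M,r}I+\kappa\tilde A_{N-1},\qquad \tilde{\mathcal P}_{N-1}=\eta_{N,M,r}I+\kappa\,s(\tilde A_{N-1}).$$ The number $M'$ in the claim does not depend on $N$ and is unrelated to $M$. *)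

(* Defs.v *)
From HB Require Import structures.
From mathcomp Require Import all_boot all_order all_algebra.
From mathcomp Require Import complex.
From mathcomp Require Import all_classical all_reals all_analysis.

Set Implicit Arguments.
Unset Strict Implicit.
Unset Printing Implicit Defensive.

Import Order.TTheory GRing.Theory Num.Theory.
Import numFieldNormedType.Exports.

Local Open Scope classical_set_scope.
Local Open Scope ring_scope.
Local Open Scope complex_scope.

(* The complex eigenvalues of a real square matrix, listed with algebraic
   multiplicity: the roots of its characteristic polynomial over R[i]. *)
Definition eigenvalues (R : realType) (n : nat) (A : 'M[R]_n) : seq R[i] :=
  sval (closed_field_poly_normal (char_poly (map_mx (real_complex R) A))).

Lemma eigenvaluesE (R : realType) (n : nat) (A : 'M[R]_n) :
  char_poly (map_mx (real_complex R) A)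
  = \prod_(z <- eigenvalues A) ('X - z%:P).
Proof.
rewrite /eigenvalues; case: closed_field_poly_normal => s /= {1}->.
by rewrite (monicP (char_poly_monic _)) scale1r.
Qed.

Definition circulant (R : realType) (n : nat) (c : nat -> R) : 'M[R]_n :=
  \matrix_(i < n, j < n) c ((i + n - j) %% n)%N.

(* In 0-based indexing, and with n = N - 1, the first column is
   A_0, A_1, ..., A_(floor((N+1)/2) - 1), A_(floor(N/2) - 1), ..., A_1,
   where A_k is the k-th entry of the first row of A; so entry k of that column
   is A_k if k < floor((n+2)/2) and A_(n-k) otherwise.  The index
   [insubd i k : 'I_n] has value k as soon as k < n; its default i is never
   reached. *)
Definition strang (R : realType) (n : nat) (A : 'M[R]_n) : 'M[R]_n :=
  \matrix_(i < n, j < n)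
    circulant n (fun k => A (insubd i 0%N)
      (insubd i (if (k < n.+2./2)%N then k else (n - k)%N))) i j.

Definition kappa_mu (R : realType) (mu : R) : R := if mu == 2 then 2 else 1.

Definition Atilde_entry (R : realType) (alpha mu : R) (N d : nat) : R :=
  let nu := mu - alpha in
  match d with
  | 0 =>
      \sum_(2 <= l < N)
         ((l%:R + 1) `^ nu - (l%:R - 1) `^ nu) / l%:R `^ mu
      + (N%:R `^ nu - (N%:R - 1) `^ nu) / N%:R `^ mu
      + (2 `^ nu + kappa_mu mu - 1)
      + 2 * nu / (alpha * N%:R `^ alpha)
  | 1 => - ((2 `^ nu + kappa_mu mu - 1) / 2)
  | _ => - (((d%:R + 1) `^ nu - (d%:R - 1) `^ nu) / (2 * d%:R `^ mu))
  end.

Definition Atilde (R : realType) (alpha mu : R) (N : nat) : 'M[R]_(N.-1) :=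
  \matrix_(i < N.-1, j < N.-1)
    Atilde_entry alpha mu N `|(j : nat)%:Z - (i : nat)%:Z|%N.

(* Euler's Gamma function, for s > 0. *)
Definition Gamma (R : realType) (s : R) : R :=
  \int[@lebesgue_measure R]_(x in `]0, +oo[) (x `^ (s - 1) * expR (- x)).

Definition tgrid (R : realType) (T : R) (M r j : nat) : R :=
  (j%:R / M%:R) ^+ r * T.

(* b^{(m,gamma)}_m *)
Definition bcoef (R : realType) (gamma T : R) (M r m : nat) : R :=
  let t0 := tgrid T M r m.-1 in
  let t1 := tgrid T M r m in
  (t1 - t0)^-1 *
  \int[@lebesgue_measure R]_(s in `[t0, t1]) ((t1 - s) `^ (- gamma)).

Definition c1 (R : realType) (alpha : R) : R :=
  2 `^ (alpha - 1) * alpha * Gamma ((alpha + 1) / 2)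
  / (Num.sqrt pi * Gamma (1 - alpha / 2)).

Definition Ch (R : realType) (alpha mu l : R) (N : nat) : R :=
  let h := 2 * l / N%:R in c1 alpha / ((mu - alpha) * h `^ alpha).

Definition eta_coef (R : realType) (gamma alpha mu T l : R) (N M r m : nat) : R :=
  bcoef gamma T M r m / (Gamma (1 - gamma) * Ch alpha mu l N).

Definition Mtilde (R : realType) (gamma alpha mu kappa T l : R)
    (N M r m : nat) : 'M[R]_(N.-1) :=
  (eta_coef gamma alpha mu T l N M r m)%:M + kappa *: Atilde alpha mu N.

Definition Ptilde (R : realType) (gamma alpha mu kappa T l : R)
    (N M r m : nat) : 'M[R]_(N.-1) :=
  (eta_coef gamma alpha mu T l N M r m)%:M + kappa *: strang (Atilde alpha mu N).

(* Main.v *)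
Require Import Defs.
From HB Require Import structures.
From mathcomp Require Import all_boot all_order all_algebra.
From mathcomp Require Import complex.
From mathcomp Require Import all_classical all_reals all_analysis.
From mathcomp Require Import zify ring lra.

Set Implicit Arguments.
Unset Strict Implicit.
Unset Printing Implicit Defensive.

Import Order.TTheory GRing.Theory Num.Theory.
Import numFieldNormedType.Exports.

(** The scalar part [eta I] cancels in the difference of the two matrices,
    which is therefore [kappa (A - s(A))].  Write [n] for the order and [a_d] for
    the entry of [A] on the diagonals at distance [d]; then [A - s(A)] is
    symmetric Toeplitz, vanishes for [d <= n/2], and equals [a_d - a_(n-d)] on
    the remaining diagonals ([Atilde_sub_strangE]).

    For [d >= 2] the entry [a_d] does not depend on [N] and is of size
    [O(d^(-1-alpha))], hence summable; quantitatively, its absolute value is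
    bounded by a constant times [(d-1)^(-alpha) - d^(-alpha)]
    ([Atilde_entry_le]), so that the tail beyond [K] telescopes to
    [O(K^(-alpha))] uniformly in [N] ([Atilde_entry_tail]).  A row [i] with
    [K <= i < n - K] only meets diagonals at distance [d < n - K], so that
    [n - d] exceeds [K], and where the entry is nonzero so does [d > n/2 > n - d].
    Fixing [K] with a small enough tail, all
    rows of [kappa (A - s(A))] but the first and last [K] have absolute sum at
    most [eps], and so have all the columns once these [2K] rows are removed
    ([strang_remainder_dominated], [sum_distn_le]).

    It remains to see that a real symmetric matrix [B] with this property, for an
    exceptional set [T] of rows, has at most [#|T|] eigenvalues of modulus
    greater than [eps] ([count_large_eigenvalues_le]).  By the Schur test, [B]
    multiplies the Euclidean norm of a row vector vanishing on [T] by at most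
    [eps].  It multiplies the norm of every nonzero combination of the
    eigenvectors with large eigenvalues by more than [eps], because these
    eigenvectors can be chosen orthonormal.  If there were more than [#|T|] of
    them, some nonzero combination would vanish on [T], which is absurd. *)

Local Open Scope ring_scope.
Local Open Scope complex_scope.

(** * Counting large eigenvalues of a symmetric matrix *)

(** With [p] the weighted sum of [x] and [W] the sum of the weights, the
    inequality comes from expanding the nonnegative sum of
    [w i * (e * x i - p) ^+ 2]: what it leaves over is [(e - W) * p ^+ 2]. *)
Lemma weighted_Cauchy_Schwarz (C : numDomainType) (I : finType) (P : pred I)
    (w x : I -> C) (e : C) :
  (forall i, 0 <= w i) -> (forall i, 0 <= x i) ->
  \sum_(i | P i) w i <= e ->
  (\sum_(i | P i) w i * x i) ^+ 2 <= e * \sum_(i | P i) w i * x i ^+ 2.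
Proof.
move=> w0 x0 We; set p := \sum_(i | P i) w i * x i.
have e0 : 0 <= e by apply: le_trans We; apply: sumr_ge0.
have p0 : 0 <= p by apply: sumr_ge0 => i _; rewrite mulr_ge0.
have [e_eq0|e_neq0] := eqVneq e 0.
  have wz i : P i -> w i = 0.
    move=> Pi; have W0 : \sum_(i | P i) w i = 0.
      by apply/eqP; rewrite eq_le {1}e_eq0 in We *; rewrite We sumr_ge0.
    by move/eqP: W0; rewrite psumr_eq0 // => /allP/(_ i (mem_index_enum i));
      rewrite Pi => /eqP.
  by rewrite /p big1 ?expr0n ?mulr_ge0 ?sumr_ge0// => i Pi;
    rewrite ?wz ?mul0r// mulr_ge0 ?exprn_ge0.
have e_gt0 : 0 < e by rewrite lt_def e_neq0.
rewrite -subr_ge0 -(pmulr_rge0 _ e_gt0).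
have : 0 <= \sum_(i | P i) w i * (e * x i - p) ^+ 2.
  apply: sumr_ge0 => i _; rewrite mulr_ge0// real_exprn_even_ge0//.
  by rewrite rpredB ?ger0_real ?mulr_ge0.
move=> /le_trans; apply.
have -> : \sum_(i | P i) w i * (e * x i - p) ^+ 2
   = e ^+ 2 * (\sum_(i | P i) w i * x i ^+ 2) - e * p ^+ 2 *+ 2
     + (\sum_(i | P i) w i) * p ^+ 2.
  have -> : e * p ^+ 2 *+ 2 = \sum_(i | P i) (w i * x i) * (e * p *+ 2).
    by rewrite -mulr_suml -/p expr2 mulrnAr mulrCA.
  rewrite mulr_sumr mulr_suml -sumrB -big_split; apply: eq_bigr => i _ /=.
  by ring.
rewrite -subr_ge0.
set W := \sum_(i | P i) w i; set Q := \sum_(i | P i) _.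
have -> : e * (e * Q - p ^+ 2) - (e ^+ 2 * Q - e * p ^+ 2 *+ 2 + W * p ^+ 2)
  = (e - W) * p ^+ 2 by ring.
by rewrite mulr_ge0 ?subr_ge0 ?exprn_ge0.
Qed.

Section Spectral.
Local Open Scope sesquilinear_scope.
Variable C : numClosedFieldType.

Lemma sqnorm_mul_unitary (m n : nat) (u : 'rV[C]_m) (V : 'M[C]_(m, n)) :
  V \is unitarymx ->
  \sum_j `|(u *m V) 0 j| ^+ 2 = \sum_j `|u 0 j| ^+ 2.
Proof.
have E k (v : 'rV[C]_k) : \sum_j `|v 0 j| ^+ 2 = (v *m v^t*) 0 0.
  by rewrite mxE; apply: eq_bigr => j _; rewrite !mxE normCK.
move=> VU; rewrite !E trmx_mul map_mxM mulmxA mulmxtVK//.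
Qed.

(** This identifies the entries of [spectral_diag A] with the eigenvalues of [A]
    counted with multiplicity. *)
Lemma char_poly_spectral (n : nat) (A : 'M[C]_n) : A \is normalmx ->
  char_poly A = \prod_(i < n) ('X - (spectral_diag A 0 i)%:P).
Proof.
move=> /orthomx_spectralP; set P := spectralmx A; set D := spectral_diag A.
move=> AE; have Pu : P \in unitmx := spectral_unit A.
have -> : \prod_(i < n) ('X - (D 0 i)%:P) = char_poly (diag_mx D).
  rewrite char_poly_trig ?diag_mx_is_trig//.
  by apply: eq_bigr => i _; rewrite !mxE eqxx mulr1n.
rewrite /char_poly /char_poly_mx {1}AE.
have PP : map_mx polyC (invmx P) *m map_mx polyC P = 1%:M.
  by rewrite -map_mxM mulVmx// map_mx1.
have -> : 'X%:M - map_mx polyC (invmx P *m diag_mx D *m P) =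
  map_mx polyC (invmx P) *m ('X%:M - map_mx polyC (diag_mx D)) *m map_mx polyC P.
  rewrite mulmxBr mulmxBl !map_mxM scalar_mxC -[_%:M *m _ *m _]mulmxA PP.
  by rewrite mulmx1.
by rewrite !det_mulmx mulrAC -det_mulmx PP det1 mul1r.
Qed.

(** A dimension count: the eigenvectors with eigenvalue of modulus greater than
    [e] span a space on which [A] expands every nonzero vector by more than [e],
    so this space meets the vectors vanishing on [T], a space of codimension
    [#|T|], only in [0]. *)
Lemma card_large_spectral_diag (n : nat) (A : 'M[C]_n) (T : {set 'I_n}) (e : C) :
  A \is normalmx -> 0 <= e ->
  (forall v : 'rV[C]_n, (forall i, i \in T -> v 0 i = 0) ->
     \sum_j `|(v *m A) 0 j| ^+ 2 <= e ^+ 2 * \sum_j `|v 0 j| ^+ 2) ->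
  (#|[set i | (e < `|spectral_diag A 0 i|)%R]| <= #|T|)%N.
Proof.
move=> /orthomx_spectralP; set P := spectralmx A; set D := spectral_diag A.
move=> AE e0 AT; set S := [set i | _].
rewrite leqNgt; apply/negP => TS.
pose f (k : 'I_#|S|) : 'I_n := enum_val k.
pose V := rowsub f P.
have PU : P \is unitarymx := spectral_unitarymx A.
have VU : V \is unitarymx.
  apply/row_unitarymxP => i j; rewrite !row_rowsub.
  by rewrite (row_unitarymxP PU) (inj_eq enum_val_inj).
(* [u *m Q] lists the coordinates in [T] of the combination [u *m V]. *)
pose Q : 'M[C]_(#|S|, #|T|) := colsub enum_val V.
have /rowV0Pn[u uQ u_neq0] : kermx Q != 0.
  rewrite kermx_eq0 -row_leq_rank -ltnNge.
  exact: leq_ltn_trans (rank_leq_col Q) TS.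
have {}uQ : u *m Q = 0 by apply/sub_kermxP.
have vT i : i \in T -> (u *m V) 0 i = 0.
  move=> iT; have /rowP/(_ (enum_rank_in iT i)) := uQ.
  by rewrite /Q mulmx_colsub mxE [RHS]mxE enum_rankK_in.
have VA : V *m A = diag_mx (colsub f D) *m V.
  rewrite {1}AE /V mul_rowsub_mx !mulmxA mulmxV ?spectral_unit// mul1mx.
  by apply/matrixP => i j; rewrite !mul_diag_mx !mxE.
have := AT _ vT.
rewrite -mulmxA VA mulmxA !(sqnorm_mul_unitary _ VU) => /le_gtF/negbT/negP; apply.
have uE j : (u *m diag_mx (colsub f D)) 0 j = u 0 j * D 0 (f j).
  by rewrite mul_mx_diag !mxE.
have fS j : e ^+ 2 < `|D 0 (f j)| ^+ 2.
  have : f j \in S by apply: enum_valP.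
  by rewrite inE => h; rewrite ltr_pXn2r// nnegrE.
have /existsP[k uk] : [exists k, u 0 k != 0].
  apply: contraNT u_neq0; rewrite negb_exists => /forallP h.
  by apply/eqP/rowP => j; rewrite mxE; apply/eqP; rewrite -[_ == _]negbK.
rewrite mulr_sumr (bigD1 k)//= [ltRHS](bigD1 k)//=; apply: ltr_leD.
  by rewrite uE normrM exprMn mulrC ltr_pM2l// exprn_gt0// normr_gt0.
apply: ler_sum => j _.
by rewrite uE normrM exprMn mulrC ler_wpM2l// ?exprn_ge0// ltW.
Qed.

(** The Euclidean operator norm is at most the geometric mean of the largest
    absolute row sum and the largest absolute column sum; for vectors vanishing
    on [T] the rows indexed by [T] do not count. *)
Lemma Schur_test (n : nat) (A : 'M[C]_n) (T : {set 'I_n}) (e : C) :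
  0 <= e ->
  (forall i, i \notin T -> \sum_j `|A i j| <= e) ->
  (forall j, \sum_(i | i \notin T) `|A i j| <= e) ->
  forall v : 'rV[C]_n, (forall i, i \in T -> v 0 i = 0) ->
     \sum_j `|(v *m A) 0 j| ^+ 2 <= e ^+ 2 * \sum_j `|v 0 j| ^+ 2.
Proof.
move=> e0 rowA colA v vT.
have restr (F : 'I_n -> C) : (forall i, v 0 i = 0 -> F i = 0) ->
    \sum_i F i = \sum_(i | i \notin T) F i.
  move=> F0; rewrite (bigID (mem T)) /= big1 ?add0r// => i iT.
  by rewrite F0// vT.
rewrite (restr (fun i => `|v 0 i| ^+ 2)); last first.
  by move=> i ->; rewrite normr0 expr0n.
apply: (@le_trans _ _
  (\sum_j e * \sum_(i | i \notin T) `|A i j| * `|v 0 i| ^+ 2)).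
  apply: ler_sum => j _.
  apply: le_trans (weighted_Cauchy_Schwarz _ _ (colA j)) => //.
  have S0 : 0 <= \sum_(i | i \notin T) `|A i j| * `|v 0 i|.
    by apply: sumr_ge0 => i _; rewrite mulr_ge0.
  rewrite (lerXn2r 2) ?nnegrE//.
  rewrite mxE restr => [|i ->]; last by rewrite mul0r.
  apply: le_trans (ler_norm_sum _ _ _) _.
  by apply: ler_sum => i _; rewrite normrM mulrC.
rewrite -mulr_sumr exchange_big /= expr2 -mulrA ler_wpM2l// mulr_sumr.
by apply: ler_sum => i iT; rewrite -mulr_suml ler_wpM2r ?exprn_ge0// rowA.
Qed.
End Spectral.

(** The complexification of [B] is Hermitian, hence normal, so the dimension count
    applies to it, with the Schur test as the bound on vectors vanishing on [T]. *)
Lemma count_large_eigenvalues_le (R : realType) (n : nat) (B : 'M[R]_n)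
    (T : {set 'I_n}) (e : R) :
  B^T = B -> 0 <= e ->
  (forall i, i \notin T -> \sum_j `|B i j| <= e) ->
  (forall j, \sum_(i | i \notin T) `|B i j| <= e) ->
  (count (fun z : R[i] => (e%:C < `|z|)%R) (eigenvalues B) <= #|T|)%N.
Proof.
move=> Bsym e0 rowB colB; set A := map_mx (real_complex R) B.
have normA i j : `|A i j| = `|B i j|%:C.
  by rewrite mxE normc_def /= expr0n addr0 sqrtr_sqr.
have AH : map_mx Num.conj A^T = A.
  apply/matrixP => i j; rewrite !mxE -{2}Bsym mxE conj_Creal//.
  by rewrite complex_real.
have An : A \is normalmx by apply/normalmxP; rewrite AH.
have eC : 0 <= e%:C :> R[i] by rewrite ler0c.
have AE : perm_eq (eigenvalues B) [seq spectral_diag A 0 i | i <- index_enum 'I_n].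
  by apply: prod_XsubC_eq; rewrite -eigenvaluesE char_poly_spectral// big_map.
rewrite (permP AE) count_map.
apply: leq_trans (card_large_spectral_diag An eC (Schur_test eC _ _)).
- by rewrite -sum1_count -sum1_card; apply/eq_leq/eq_bigl => i; rewrite inE.
- move=> i iT; under eq_bigr => j _ do rewrite normA.
  by rewrite -rmorph_sum lecR rowB.
- move=> j; under eq_bigr => i _ do rewrite normA.
  by rewrite -rmorph_sum lecR colB.
Qed.

(** * Decay of the coefficients *)

(** After factoring out [k `^ nu], with [x = 1/k] in [(0, 1]] and [nu <= 2] one
    has [(1 + x) `^ nu <= (1 + x) ^+ 2 <= 1 + 3 x] and
    [(1 - x) `^ nu >= (1 - x) ^+ 2 >= 1 - 2 x], whence the constant [5]. *)
Lemma powR_diff_le (R : realType) (k : nat) (nu : R) :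
  0 <= nu <= 2 -> (0 < k)%N ->
  0 <= (k%:R + 1) `^ nu - (k%:R - 1) `^ nu <= 5 * k%:R `^ nu / k%:R.
Proof.
move=> /andP[nu0 nu2] k0.
have kR : 0 < k%:R :> R by rewrite ltr0n.
have k1 : 1 <= k%:R :> R by rewrite ler1n.
apply/andP; split.
  by rewrite subr_ge0 ge0_ler_powR// ?nnegrE; lra.
set x : R := k%:R^-1.
have x0 : 0 < x by rewrite invr_gt0.
have x1 : x <= 1 by rewrite invf_le1.
have kx : k%:R * x = 1 by rewrite divff// gt_eqF.
have -> : k%:R + 1 = k%:R * (1 + x) by rewrite mulrDr kx mulr1.
have -> : k%:R - 1 = k%:R * (1 - x) by rewrite mulrBr kx mulr1.
rewrite !powRM ?(ltW kR) ?subr_ge0//; last by lra.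
rewrite -mulrBr mulrAC -/x [5 * x * _]mulrC ler_wpM2l ?powR_ge0//.
have up : (1 + x) `^ nu <= (1 + x) ^+ 2.
  by rewrite -powR_mulrn; [apply: ler_powR; lra|lra].
have lo : (1 - x) ^+ 2 <= (1 - x) `^ nu.
  have [->|x_neq1] := eqVneq x 1; first by rewrite subrr expr0n powR_ge0.
  have xlt : x < 1 by rewrite lt_neqAle x_neq1.
  by rewrite -powR_mulrn ?ger_powR//; lra.
nra.
Qed.

(** The integral comparison for the series of [k `^ (- 1 - alpha)], obtained
    from [expR y >= 1 + y] and [ln (1 - x) <= - x] with [x = 1/k]. *)
Lemma telescope_powRN (R : realType) (alpha : R) (k : nat) :
  0 < alpha -> (1 < k)%N ->
  alpha * (k%:R `^ (- alpha) / k%:R) <= k.-1%:R `^ (- alpha) - k%:R `^ (- alpha).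
Proof.
move=> a0 k1; set x : R := k%:R^-1.
have kR : 1 < k%:R :> R by rewrite ltr1n.
have x0 : 0 < x by rewrite invr_gt0; lra.
have x1 : x < 1 by rewrite invf_lt1//; lra.
have -> : k.-1%:R = k%:R * (1 - x).
  by rewrite mulrBr mulr1 divff ?gt_eqF -?subn1 ?natrB; lra || lia.
rewrite powRM; [|lra..].
have : 1 + alpha * x <= (1 - x) `^ (- alpha).
  rewrite /powR gt_eqF; last by lra.
  apply: le_trans (expR_ge1Dx _); rewrite lerD2l.
  have : ln (1 - x) <= - x by apply: le_ln1Dx; lra.
  nra.
have := powR_ge0 k%:R (- alpha) : 0 <= _ :> R.
rewrite -/x; nra.
Qed.

Lemma powRN_small (R : realType) (a e : R) : 0 < a -> 0 < e ->
  exists2 K : nat, (0 < K)%N & K%:R `^ (- a) <= e.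
Proof.
move=> a0 e0; exists (Num.truncn (e^-1 `^ a^-1)).+1 => //.
set K := _.+1.
have h : e^-1 `^ a^-1 <= K%:R by apply/ltW/truncnS_gt.
rewrite powRN -(invrK e) lef_pV2 ?posrE ?invr_gt0 ?powR_gt0 ?ltr0n//.
apply: le_trans (ge0_ler_powR (ltW a0) _ _ h); rewrite ?nnegrE ?powR_ge0//.
by rewrite -powRrM mulVf ?gt_eqF// powRr1// invr_ge0 ltW.
Qed.

(** * The matrix A - s(A) *)

(** Each distance is attained at most twice, once on each side of [i]. *)
Lemma sum_distn_le (R : numDomainType) (n i : nat) (F : nat -> R) :
  (i < n)%N -> (forall d, 0 <= F d) ->
  \sum_(j < n) F `|j%:Z - i%:Z|%N <= 2 * \sum_(d < n) F d.
Proof.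
move=> i_n F0.
rewrite -(big_mkord xpredT (fun j => F `|j%:Z - i%:Z|%N)) -(big_mkord xpredT F).
rewrite (big_cat_nat (n := i))//=; last exact: ltnW.
have trunc m : (m <= n)%N -> \sum_(0 <= d < m) F d <= \sum_(0 <= d < n) F d.
  by move=> mn; rewrite (big_cat_nat (n := m) (p := n))//= lerDl sumr_ge0.
rewrite mulr_natl mulr2n addrC lerD//.
  rewrite -{1}(add0n i) big_addn; apply: le_trans (trunc (n - i)%N _); last by lia.
  by apply: ler_sum_nat => j _; have -> : `|(j + i)%N%:Z - i%:Z|%N = j by lia.
rewrite big_nat_rev /= add0n.
apply: le_trans (trunc i.+1 _) => //; rewrite big_nat_recl// ler_wpDl//.
apply: ler_sum_nat => j ji.
by have -> : `|(i - j.+1)%N%:Z - i%:Z|%N = j.+1 by lia.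
Qed.

Lemma card_boundary_le (n K : nat) :
  (#|[set i : 'I_n | (i < K) || (n <= i + K)]| <= 2 * K)%N.
Proof.
set T := [set i | _].
have -> : (2 * K = size (iota 0 K ++ iota (n - K) K))%N.
  by rewrite size_cat !size_iota; lia.
rewrite cardE -(size_map val); apply: uniq_leq_size.
  by rewrite map_inj_uniq ?enum_uniq//; exact: val_inj.
move=> _ /mapP[i iT ->]; rewrite mem_enum inE in iT.
by have := ltn_ord i; rewrite mem_cat !mem_iota /=; lia.
Qed.

(** The range [k > 1] is where the entry is given by the generic formula, with
    no dependence on [N]. *)
Lemma Atilde_entry_le (R : realType) (alpha mu : R) (N k : nat)
    (a0 : 0 < alpha) (hmu : alpha < mu <= 2) : (1 < k)%N ->
  `|Atilde_entry alpha mu N k|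
  <= 5 / (2 * alpha) * (k.-1%:R `^ (- alpha) - k%:R `^ (- alpha)).
Proof.
move=> k1; case/andP: (hmu) => amu mu2.
have kR : 0 < k%:R :> R by rewrite ltr0n; lia.
have nu02 : 0 <= mu - alpha <= 2 by apply/andP; split; lra.
have k0 : (0 < k)%N by lia.
have /andP[d0 d5] := powR_diff_le nu02 k0.
have -> : Atilde_entry alpha mu N k =
  - (((k%:R + 1) `^ (mu - alpha) - (k%:R - 1) `^ (mu - alpha)) / (2 * k%:R `^ mu)).
  by case: k k1 {kR k0 d0 d5} => [|[|k]].
have kmu : 0 < k%:R `^ mu by rewrite powR_gt0.
rewrite normrN ger0_norm ?divr_ge0 ?mulr_ge0 ?(ltW kmu)//.
have := telescope_powRN a0 k1; rewrite mulrC -ler_pdivlMr// => tel.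
have -> : 5 / (2 * alpha) * (k.-1%:R `^ (- alpha) - k%:R `^ (- alpha))
  = 5 / 2 * ((k.-1%:R `^ (- alpha) - k%:R `^ (- alpha)) / alpha).
  by field; rewrite gt_eqF.
apply: (@le_trans _ _ (5 / 2 * (k%:R `^ (- alpha) / k%:R))); last first.
  by rewrite ler_wpM2l//; lra.
rewrite ler_pdivrMr ?mulr_gt0//; apply: le_trans d5 _.
rewrite le_eqVlt; apply/orP; left; apply/eqP.
have -> : k%:R `^ (mu - alpha) = k%:R `^ mu * k%:R `^ (- alpha).
  by rewrite powRD // pnatr_eq0 -lt0n k0 implybT.
by field; rewrite gt_eqF.
Qed.

Lemma Atilde_entry_tail (R : realType) (alpha mu : R) (N K m : nat)
    (a0 : 0 < alpha) (hmu : alpha < mu <= 2) : (0 < K)%N ->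
  \sum_(K.+1 <= k < m) `|Atilde_entry alpha mu N k|
  <= 5 / (2 * alpha) * K%:R `^ (- alpha).
Proof.
move=> K0.
have C0 : 0 <= 5 / (2 * alpha) by rewrite divr_ge0// mulr_ge0// ltW.
have [mK|Km] := leqP m K.+1.
  by rewrite big_geq// mulr_ge0// powR_ge0.
apply: (@le_trans _ _ (\sum_(K.+1 <= k < m)
    5 / (2 * alpha) * (k.-1%:R `^ (- alpha) - k%:R `^ (- alpha)))).
  by apply: ler_sum_nat => k kK; apply: Atilde_entry_le; lia.
rewrite -mulr_sumr ler_wpM2l//.
rewrite (@telescope_sumr_eq _ _ _ (fun k => - k.-1%:R `^ (- alpha))) 1?ltnW//.
  by rewrite opprK addrC gerDl oppr_le0 powR_ge0.
by move=> k _; rewrite opprK addrC.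
Qed.

Lemma Atilde_sub_strangE (R : realType) (alpha mu : R) (N : nat) (i j : 'I_N.-1) :
  let d := `|(j : nat)%:Z - (i : nat)%:Z|%N in
  (Atilde alpha mu N - strang (Atilde alpha mu N)) i j =
  if (d < N.-1.+2./2)%N then 0
  else Atilde_entry alpha mu N d - Atilde_entry alpha mu N (N.-1 - d).
Proof.
move=> d; rewrite !mxE; set n := N.-1 in i j d *.
have i_n := ltn_ord i; have j_n := ltn_ord j.
set k := ((i + n - j) %% n)%N; set k' := if _ then _ else _.
have kE : k = (if (j <= i)%N then d else n - d)%N.
  rewrite /k; case: leqP => ij.
    have -> : (i + n - j = (i - j) + n)%N by lia.
    by rewrite modnDr modn_small; lia.
  by rewrite modn_small; lia.
have k'E : k' = (if (d < n.+2./2)%N then d else n - d)%N.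
  rewrite /k' kE; case: (leqP j i) => ij; do 2?[case: ifP => ?]; lia.
have dn : (d < n)%N by lia.
have k'n : (k' < n)%N by rewrite k'E; case: ifP; lia.
rewrite !val_insubd k'n; have -> : (0 < n)%N by lia.
rewrite subr0 absz_nat k'E; case: ifP => _; last by [].
by rewrite subrr.
Qed.

(** Domination by a function of the distance alone, rather than a bound on the
    row sums, serves both the rows and the columns of the symmetric matrix
    [A - s(A)]. *)
Lemma strang_remainder_dominated (R : realType) (alpha mu : R) (N K : nat)
    (a0 : 0 < alpha) (hmu : alpha < mu <= 2) : (0 < K)%N ->
  exists w : nat -> R, [/\ forall d, 0 <= w d,
    \sum_(d < N.-1) w d <= 5 / alpha * K%:R `^ (- alpha) &
    forall i j : 'I_N.-1, (K <= i)%N -> (i + K < N.-1)%N ->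
      `|(Atilde alpha mu N - strang (Atilde alpha mu N)) i j|
      <= w `|(j : nat)%:Z - (i : nat)%:Z|%N].
Proof.
move=> K0; set n := N.-1.
pose t k : R := if (K < k)%N then `|Atilde_entry alpha mu N k| else 0.
have t0 k : 0 <= t k by rewrite /t; case: ifP.
have sum_t m : \sum_(0 <= k < m) t k <= 5 / (2 * alpha) * K%:R `^ (- alpha).
  apply: le_trans (Atilde_entry_tail N m a0 hmu K0).
  rewrite (big_nat_widenl K.+1 0 m) // [leRHS]big_mkcond /=.
  by apply: ler_sum => k _; rewrite /t.
(* In a row [i] with [K <= i < n - K] the distance stays below [n - K]; as it
   exceeds [n/2] where the entry is nonzero, [d] and [n - d] both exceed [K]. *)
pose w d : R := if (n.+2./2 <= d < n - K)%N then t d + t (n - d)%N else 0.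
have w0 d : 0 <= w d by rewrite /w; case: ifP => // _; rewrite addr_ge0.
exists w; split=> [//||i j Ki iK].
  have -> : 5 / alpha * K%:R `^ (- alpha)
     = 5 / (2 * alpha) * K%:R `^ (- alpha) + 5 / (2 * alpha) * K%:R `^ (- alpha).
    by field; rewrite gt_eqF.
  apply: (@le_trans _ _ (\sum_(0 <= d < n) (t d + t (n - d)%N))).
    rewrite big_mkord; apply: ler_sum => d _; rewrite /w; case: ifP => // _.
    by rewrite addr_ge0.
  rewrite big_split/= lerD ?sum_t//.
  (* Reversal sends [n - d] to the range from [1] to [n], one step beyond the
     range of [d]. *)
  apply: le_trans (sum_t n.+1).
  rewrite big_nat_rev [leRHS]big_nat_recl//= ler_wpDl//.
  apply: ler_sum_nat => d dn.
  by have -> : (n - (0 + n - d.+1))%N = d.+1 by lia.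
rewrite Atilde_sub_strangE -/n.
have i_n := ltn_ord i; have j_n := ltn_ord j.
set d := `|_ - _|%N; case: ltnP => hd; first by rewrite normr0.
have -> : w d = t d + t (n - d)%N by rewrite /w hd ifT//; lia.
rewrite /t !ifT; [|lia..].
exact: ler_normB.
Qed.

Lemma strang_remainder_sym (R : realType) (alpha mu : R) (N : nat) :
  (Atilde alpha mu N - strang (Atilde alpha mu N))^T
  = Atilde alpha mu N - strang (Atilde alpha mu N).
Proof.
by apply/matrixP => i j; rewrite mxE !Atilde_sub_strangE distnC.
Qed.

Theorem theorem3p1 (R : realType) (gamma alpha mu kappa T l : R)
  (Mf rf mf : nat -> nat) (eta_lo eta_hi : R)
  (hgamma : 0 < gamma < 1) (halpha : 0 < alpha < 2) (hmu : alpha < mu <= 2)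
  (hkappa : 0 < kappa) (hT : 0 < T) (hl : 0 < l)
  (hM : forall N : nat, (2 <= N)%N -> (0 < Mf N)%N)
  (hr : forall N : nat, (2 <= N)%N -> (0 < rf N)%N)
  (hm : forall N : nat, (2 <= N)%N -> (1 <= mf N <= Mf N)%N)
  (heta_lo : 0 < eta_lo)
  (heta : forall N : nat, (2 <= N)%N ->
     eta_lo <= eta_coef gamma alpha mu T l N (Mf N) (rf N) (mf N) <= eta_hi) :
  forall eps : R, 0 < eps < 1 ->
  exists N' M' : nat, (0 < M')%N /\
    forall N : nat, (N' < N)%N ->
      (count (fun z : R[i] => (eps%:C < `|z|)%R)
         (eigenvalues
            (Mtilde gamma alpha mu kappa T l N (Mf N) (rf N) (mf N)
             - Ptilde gamma alpha mu kappa T l N (Mf N) (rf N) (mf N)))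
       <= 2 * M')%N.
Proof.
move=> eps /andP[eps0 _]; have /andP[a0 _] := halpha.
have C0 : 0 < 2 * (kappa * (5 / alpha)) by rewrite !mulr_gt0// invr_gt0.
have [K K0 hK] := powRN_small a0 (divr_gt0 eps0 C0).
exists 0%N, K; split=> // N _.
rewrite /Mtilde /Ptilde [X in X - _]addrC addrKA -scalerBr.
set D := Atilde alpha mu N - _.
have DT : D^T = D := strang_remainder_sym alpha mu N.
have [w [w0 w_sum w_dom]] := strang_remainder_dominated N a0 hmu K0.
have sum_eps (i : 'I_N.-1) :
    kappa * \sum_(j < N.-1) w `|(j : nat)%:Z - (i : nat)%:Z|%N <= eps.
  apply: (@le_trans _ _ (kappa * (2 * (5 / alpha * K%:R `^ (- alpha))))).
    rewrite ler_pM2l//; apply: le_trans (sum_distn_le (ltn_ord i) w0) _.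
    by rewrite ler_wpM2l.
  move: hK; rewrite ler_pdivlMr//; apply: le_trans.
  by rewrite le_eqVlt; apply/orP; left; apply/eqP; ring.
pose T' := [set i : 'I_N.-1 | (i < K) || (N.-1 <= i + K)]%N.
have dom i j : i \notin T' ->
    `|(kappa *: D) i j| <= kappa * w `|(j : nat)%:Z - (i : nat)%:Z|%N.
  rewrite inE negb_or -leqNgt -ltnNge => /andP[Ki iK].
  by rewrite mxE normrM gtr0_norm// ler_pM2l//; exact: w_dom.
apply: leq_trans (card_boundary_le N.-1 K).
apply: count_large_eigenvalues_le.
- by rewrite linearZ /= DT.
- exact: ltW.
- move=> i iT; apply: le_trans (sum_eps i); rewrite mulr_sumr.
  by apply: ler_sum => j _; exact: dom.
- move=> j; apply: le_trans (sum_eps j); rewrite mulr_sumr.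
  rewrite [leRHS](bigID (mem T')) /= ler_wpDl//.
    by apply: sumr_ge0 => i _; rewrite mulr_ge0// ltW.
  by apply: ler_sum => i iT; rewrite distnC; exact: dom.
Qed.
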